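(* For every graph $H$ with at least one edge there are positive constants $c_H$ and $c'_H$ such that, for every positive integer $n$: (i) $S(H,n,b) \leq c_H \cdot n^{v(H)} (b+1)^{-e(H)}$ for every integer $b \geq 1$; (ii) if $b \geq c'_H \cdot n^{1/m(H)}$, then $S(H,n,b)=0$.
   Context: A biased $(b:1)$ Waiter-Client game $(X,\mathcal F)$ (with $X$ a finite set, $\mathcal F$ a family of subsets of $X$, $b$ a positive integer) is played in rounds: in each round Waiter selects exactly $b+1$ elements of $X$ not previously selected and offers them to Client; Client keeps one of them and the other $b$ go to Waiter. If at some point at most $b$ free elements remain, they all go to Waiter. The value of the game is the number of sets $A\in\mathcal F$ all of whose elements were claimed by Client at the end, assuming optimal play (Waiter maximizes, Client minimizes). For a graph $H$, $S(H,n,b)$ denotes the value of the $(b:1)$ Waiter-Client game whose board is the edge set of $K_n$ and whose winning sets are the edge sets of all copies of $H$ in $K_n$. $v(G)$, $e(G)$ denote the number of vertices and edges of $G$, and $m(H)=\max\{e(H')/v(H') : H'\subseteq H, v(H')\geq 1\}$. *)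

(* Defs.v *)
From HB Require Import structures.
From mathcomp Require Import all_boot all_order all_algebra.
From mathcomp Require Import reals.

Set Implicit Arguments.
Unset Strict Implicit.
Unset Printing Implicit Defensive.

Import Order.TTheory GRing.Theory Num.Theory.

Record sgraph := SGraph {
  vertex : finType;
  adj : rel vertex;
  adj_sym : symmetric adj;
  adj_irr : irreflexive adj }.

Definition edges (G : sgraph) : {set {set vertex G}} :=
  [set [set p.1; p.2] | p : vertex G * vertex G & adj p.1 p.2].

Definition nverts (G : sgraph) : nat := #|vertex G|.
Definition nedges (G : sgraph) : nat := #|edges G|.

Lemma neq_sym (T : eqType) : symmetric (fun x y : T => x != y).
Proof. by move=> x y; rewrite eq_sym. Qed.

Lemma neq_irr (T : eqType) : irreflexive (fun x y : T => x != y).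
Proof. by move=> x; rewrite eqxx. Qed.

Definition complete_graph (n : nat) : sgraph :=
  SGraph (@neq_sym 'I_n) (@neq_irr 'I_n).

(* A subgraph need not be induced: it is a vertex set together with a set of
   edges of [G] whose endpoints all lie in that vertex set. *)
Definition subgraph (G : sgraph) (W : {set vertex G})
    (D : {set {set vertex G}}) : bool :=
  (D \subset edges G) && (cover D \subset W).

(* The default value 0 of the maximum is harmless, all ratios being >= 0. *)
Definition max_density (R : realType) (G : sgraph) : R :=
  (\big[Num.max/0]_(P : {set vertex G} * {set {set vertex G}} |
      subgraph P.1 P.2 && (0 < #|P.1|)%N) (#|P.2|%:R / #|P.1|%:R))%R.

(* The family is a set of edge sets: when [H] has isolated vertices, copies
   of [H] with the same edges yield a single winning set. *)
Definition copies (H G : sgraph) : {set {set {set vertex G}}} :=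
  [set [set f @: d | d : {set vertex H} in edges H]
     | f : {ffun vertex H -> vertex G}
     & injectiveb f && [forall d in edges H, f @: d \in edges G]].

Section WaiterClient.
Variables (T : finType) (F : {set {set T}}) (b : nat).

Definition score (C : {set T}) : nat := #|[set A in F | A \subset C]|.

(* Backward-induction value of the position where the elements of [U] are free
   and Client owns [C].  The default value #|F| of the minimum is harmless
   because it bounds every score. The fuel [k] only ensures termination: any
   [k >= #|U|] is enough, see [position_valueE]. *)
Fixpoint position_value (k : nat) (U C : {set T}) : nat :=
  if k is k'.+1 then
    if #|U| <= b then score C
    else \max_(Q : {set T} | (Q \subset U) && (#|Q| == b.+1))
           \big[minn/#|F|]_(x in Q) position_value k' (U :\: Q) (x |: C)
  else score C.

Definition game_value (X : {set T}) : nat := position_value #|X| X set0.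

Lemma position_value_fuel (k l : nat) (U C : {set T}) :
  #|U| <= k -> #|U| <= l -> position_value k U C = position_value l U C.
Proof.
elim: k l U C => [|k IHk] [|l] U C //= Uk Ul.
- by rewrite (leq_trans Uk).
- by rewrite (leq_trans Ul).
case: ifP => // _; apply: eq_bigr => Q /andP[QU /eqP cQ].
apply: eq_bigr => x _; apply: IHk; rewrite cardsDS // cQ;
  by rewrite leq_subLR addSnnS (leq_trans _ (leq_addl _ _)).
Qed.

Lemma position_valueE (U C : {set T}) :
  position_value #|U| U C =
    if #|U| <= b then score C
    else \max_(Q : {set T} | (Q \subset U) && (#|Q| == b.+1))
           \big[minn/#|F|]_(x in Q)
             position_value #|U :\: Q| (U :\: Q) (x |: C).
Proof.
rewrite (@position_value_fuel _ #|U|.+1) //=.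
case: ifP => // _; apply: eq_bigr => Q /andP[QU _].
by apply: eq_bigr => x _; apply: position_value_fuel => //; apply/subset_leq_card/subsetDl.
Qed.

Lemma position_value_le (k : nat) (U C : {set T}) :
  position_value k U C <= #|F|.
Proof.
have sc D : score D <= #|F|.
  by apply: subset_leq_card; apply/subsetP => A; rewrite inE => /andP[].
case: k => [|k] //=; case: ifP => // _.
apply/bigmax_leqP => Q _.
by elim/big_rec: _ => // x m _ mF; rewrite geq_min mF orbT.
Qed.

End WaiterClient.

Definition WC_value (H : sgraph) (n b : nat) : nat :=
  game_value (copies H (complete_graph n)) b (edges (complete_graph n)).

(* Main.v *)
Require Import Defs.
From HB Require Import structures.
From mathcomp Require Import all_boot all_order all_algebra.
From mathcomp Require Import reals exp.

(** Client keeps under control the potential [sum_A (b+1)^-|A \ C|], the sum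
    being over the winning sets [A] containing no element of Waiter. If Client
    picked a uniformly random offered element, the expected potential would not
    increase: a set meeting the offer in one element survives with probability
    [1/(b+1)] and its weight is then multiplied by [b+1], and a set meeting the
    offer in several elements dies. Hence some choice does not increase the
    potential, and the value of the game is at most [|F| (b+1)^-k] when all
    winning sets have [k] elements. Applied to the copies of [H] this gives (i);
    applied to a densest subgraph of [H] it bounds the value by a number smaller
    than 1, whence (ii). *)

Set Implicit Arguments.
Unset Strict Implicit.
Unset Printing Implicit Defensive.

Import Order.TTheory GRing.Theory Num.Theory.
Local Open Scope ring_scope.

Lemma bigminn_le (I : finType) (Q : {set I}) (m : nat) (v : I -> nat) x :
  x \in Q -> (\big[minn/m]_(y in Q) v y <= v x)%N.
Proof. exact: (@bigmin_le_cond _ nat). Qed.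

Lemma eq_bigminn (I : finType) (Q : {set I}) (m : nat) (v : I -> nat) x0 :
  x0 \in Q -> (forall x, x \in Q -> v x <= m)%N ->
  exists2 x, x \in Q & \big[minn/m]_(y in Q) v y = v x.
Proof.
by move=> x0Q vm; have [x] := @eq_bigmin _ nat _ _ x0 (mem Q) v x0Q vm; exists x.
Qed.

Section Potential.
Variables (R : realFieldType) (T : finType) (b : nat).
Implicit Types (F : {set {set T}}) (A C Q U : {set T}).

(** Waiter owns what lies outside [C :|: U], so the test discards the sets already hit by Waiter. *)
Definition weight U C A : R :=
  if A \subset C :|: U then b.+1%:R ^- #|A :\: C| else 0.

Definition potential F U C : R := \sum_(A in F) weight U C A.

Lemma weight_ge0 U C A : 0 <= weight U C A.
Proof. by rewrite /weight; case: ifP => // _; rewrite invr_ge0 exprn_ge0. Qed.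

Lemma weight_le U C A : weight U C A <= b.+1%:R ^- #|A :\: C|.
Proof. by rewrite /weight; case: ifP => // _; rewrite invr_ge0 exprn_ge0. Qed.

(** Each set that Client has completed weighs 1, whatever is still free. *)
Lemma score_le_potential F U C : (score F C)%:R <= potential F U C.
Proof.
rewrite /score -sum1_card natr_sum big_mkcond [leRHS]big_mkcond /=.
apply: ler_sum => A _; rewrite inE.
case: (A \in F) => //=; case: ifP => [AC | _]; last exact: weight_ge0.
rewrite /weight (subset_trans AC (subsetUl _ _)).
by move: AC; rewrite -setD_eq0 => /eqP ->; rewrite cards0 expr0 invr1.
Qed.

Lemma sum_weight_offer U C Q A : Q \subset U -> #|Q| = b.+1 ->
  \sum_(x in Q) weight (U :\: Q) (x |: C) A <= b.+1%:R * weight U C A.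
Proof.
move=> QU cQ.
have [ACU|nACU] := boolP (A \subset C :|: U); last first.
  rewrite big1 ?mulr_ge0 ?weight_ge0 // => x xQ; rewrite /weight ifN //.
  apply: contra nACU => /subset_trans; apply.
  by rewrite !subUset subsetUl sub1set inE (subsetP QU) ?orbT //= subDset
             subsetU // subsetUr orbT.
(* If [A] needs some offered [y], every other choice gives [y] to Waiter and kills [A], while
   choosing [y] lowers the exponent by one. If it needs none, each of the [b.+1] choices leaves the
   exponent unchanged. *)
have [y /setIP[/setDP[Ay nCy] Qy]|AQ0] := pickP (mem ((A :\: C) :&: Q)).
  rewrite (bigD1 y) //= big1 ?addr0 => [|x /andP[xQ xy]]; last first.
    rewrite /weight ifN //; apply/negP => /subsetP /(_ y Ay).
    by rewrite !inE eq_sym (negPf xy) (negPf nCy) Qy.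
  apply: le_trans (weight_le _ _ _) _.
  rewrite /weight ACU (cardsD1 y (A :\: C)) in_setD nCy Ay setDDl setUC.
  by rewrite add1n exprS invfM mulVKf // pnatr_eq0.
apply: (@le_trans _ _ (\sum_(x in Q) weight U C A)); last first.
  by rewrite sumr_const cQ mulr_natl.
apply: ler_sum => x xQ; apply: le_trans (weight_le _ _ _) _.
rewrite /weight ACU setUC -setDDl (setDidPl _) //.
rewrite disjoint_sym disjoints1; apply/negP => xAC.
by have := AQ0 x; rewrite /= inE xAC xQ.
Qed.

Lemma potential_offer F U C Q : Q \subset U -> #|Q| = b.+1 ->
  exists2 x, x \in Q & potential F (U :\: Q) (x |: C) <= potential F U C.
Proof.
move=> QU cQ; apply/exists_inP; apply: contraT => /exists_inPn small.
have : \sum_(x in Q) potential F (U :\: Q) (x |: C)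
       <= \sum_(x in Q) potential F U C.
  rewrite exchange_big sumr_const cQ -mulr_natl mulr_sumr /=.
  by apply: ler_sum => A _; apply: sum_weight_offer.
rewrite leNgt ltr_sum // => [|x xQ]; last by rewrite ltNge small.
(* Strictness of the summed inequality needs at least one term. *)
have /card_gt0P[x xQ] : (0 < #|Q|)%N by rewrite cQ.
by apply/hasP; exists x; rewrite ?mem_index_enum.
Qed.

Lemma position_value_le_potential F k U C :
  (position_value F b k U C)%:R <= potential F U C.
Proof.
elim: k U C => [|k IHk] U C /=; first exact: score_le_potential.
case: ifP => _; first exact: score_le_potential.
elim/big_ind: _ => [|u v|Q /andP[QU /eqP cQ]].
- by apply: sumr_ge0 => A _; apply: weight_ge0.
- by case: (leqP u v).
have [x xQ] := potential_offer F C QU cQ; apply: le_trans.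
apply: le_trans (IHk _ _); rewrite ler_nat; exact: bigminn_le.
Qed.

Lemma game_value_le F X k : (forall A, A \in F -> #|A| = k) ->
  (game_value F b X)%:R <= #|F|%:R * b.+1%:R ^- k :> R.
Proof.
move=> Fk; apply: le_trans (position_value_le_potential _ _ _ _) _.
rewrite mulr_natl -sumr_const; apply: ler_sum => A AF.
by rewrite -(Fk A AF) -[in leRHS](setD0 A) weight_le.
Qed.

End Potential.

(** Client copies an optimal strategy for [F']: the choice attaining the minimum for [F'] keeps that
    value at 0, and by induction it also gives 0 for [F]. *)
Lemma position_value_eq0 (T : finType) (F F' : {set {set T}}) b k U C :
  (forall D, score F' D = 0 -> score F D = 0)%N ->
  position_value F' b k U C = 0%N -> position_value F b k U C = 0%N.
Proof.
move=> F0; elim: k U C => [|k IHk] U C /=; first exact: F0.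
case: ifP => _; first exact: F0.
move=> v0; apply/eqP; rewrite -leqn0; apply/bigmax_leqP => Q PQ.
have /card_gt0P[x0 x0Q] : (0 < #|Q|)%N by case/andP: PQ => _ /eqP->.
have [x xQ minE] := eq_bigminn x0Q (fun x (_ : x \in Q) =>
  position_value_le F' b k (U :\: Q) (x |: C)).
apply: leq_trans (bigminn_le _ _ xQ) _; rewrite leqn0; apply/eqP/IHk.
by apply/eqP; rewrite -minE -leqn0 -v0; apply: (bigop.bigmax_sup Q).
Qed.

(* As the edges in [D] only see the vertices in [W], the maps are taken to be
   constant outside [W], so as to count [n ^ #|W|] of them. *)
Definition partial_copies (V V' : finType) (y0 : V') (W : {set V})
    (D : {set {set V}}) : {set {set {set V'}}} :=
  [set A in [set [set f @: d | d : {set V} in D]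
               | f : {ffun V -> V'} in pffun_on y0 W predT] | #|A| == #|D|].

Lemma card_partial_copies (V V' : finType) (y0 : V') (W : {set V}) D :
  (#|partial_copies y0 W D| <= #|V'| ^ #|W|)%N.
Proof.
rewrite -(card_pffun_on y0 W).
apply: leq_trans (leq_imset_card (fun f : {ffun V -> V'} =>
  [set f @: d | d : {set V} in D]) _).
by apply/subset_leq_card/subsetP => A; rewrite inE => /andP[].
Qed.

Lemma card_imset_imset (V V' : finType) (f : V -> V') (D : {set {set V}}) :
  injective f -> #|[set f @: d | d : {set V} in D]| = #|D|.
Proof. by move=> /imset_inj; apply: card_imset. Qed.

(** A copy of [H] owned by Client contains the image of [D], which is a partial copy. *)
Lemma partial_copies_score_eq0 (H G : sgraph) (y0 : vertex G)
    (W : {set vertex H}) D (C : {set {set vertex G}}) : subgraph W D ->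
  score (partial_copies y0 W D) C = 0%N -> score (copies H G) C = 0%N.
Proof.
move=> /andP[DH DW] /eqP; rewrite cards_eq0 => /eqP s0.
apply/eqP; rewrite cards_eq0 -subset0; apply/subsetP => A.
rewrite inE => /andP[/imsetP[f]]; rewrite inE => /andP[/injectiveP f_inj _] -> fC.
have := in_set0 [set f @: d | d : {set vertex H} in D].
rewrite -{}s0 !inE card_imset_imset // eqxx andbT => /negbT/negP; case.
rewrite (subset_trans (imsetS _ DH) fC) andbT.
(* Resetting [f] outside [W] does not move the edges of [D], which lie inside [W]. *)
apply/imsetP; exists [ffun x => if x \in W then f x else y0].
  apply/pffun_onP; split=> //.
  by apply/supportP => x xW; rewrite ffunE (negPf xW).
apply: eq_in_imset => d dD; apply: eq_in_imset => x xd.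
by rewrite ffunE (subsetP DW) //; apply/bigcupP; exists d.
Qed.

Lemma card_copies_le (H : sgraph) n :
  (#|copies H (complete_graph n)| <= n ^ nverts H)%N.
Proof.
apply: leq_trans (leq_imset_card _ _) _; apply: leq_trans (max_card _) _.
by rewrite card_ffun card_ord.
Qed.

Lemma card_copy (H G : sgraph) A : A \in copies H G -> #|A| = nedges H.
Proof.
case/imsetP=> f; rewrite inE => /andP[/injectiveP f_inj _] ->.
exact: card_imset_imset.
Qed.

Lemma max_densityP (R : realType) (G : sgraph) : (0 < nedges G)%N ->
  exists (W : {set vertex G}) D, [/\ subgraph W D, (0 < #|W|)%N, (0 < #|D|)%N &
    max_density R G = #|D|%:R / #|W|%:R].
Proof.
move=> G_gt0.
(* [G] itself is an admissible pair, so the maximum is attained; its positive density later forces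
   [D] to be nonempty. *)
have GT : @subgraph G setT (edges G) && (0 < #|[set: vertex G]|)%N.
  rewrite /subgraph subxx subsetT /=.
  case/card_gt0P: G_gt0 => d /imsetP[[x y] _ _].
  by apply/card_gt0P; exists x.
pose dens (P : {set vertex G} * {set {set vertex G}}) : R :=
  #|P.2|%:R / #|P.1|%:R.
have [|[W D] /andP[/= WD W_gt0] denE] := @eq_bigmax _ R _ 0 (setT, edges G)
    [pred P | @subgraph G P.1 P.2 && (0 < #|P.1|)%N] dens GT.
  by move=> P _; rewrite divr_ge0.
exists W, D; split=> //.
have : 0 < dens (W, D).
  rewrite -denE; apply: lt_le_trans (le_bigmax_cond (j := (setT, edges G)) 0 dens GT).
  by rewrite divr_gt0 // ltr0n //; case/andP: GT.
by rewrite /dens /= lt0n; case: eqP => // ->; rewrite mul0r ltxx.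
Qed.

Theorem theorem1p3 (R : realType) (H : sgraph) (hH : (0 < nedges H)%N) :
  exists c c' : R, [/\ 0 < c, 0 < c' &
    forall n : nat, (0 < n)%N ->
      (forall b : nat, (1 <= b)%N ->
         (WC_value H n b)%:R
           <= c * n%:R ^+ nverts H * (b%:R + 1) ^- nedges H) /\
      (forall b : nat, (1 <= b)%N ->
         c' * n%:R `^ (1 / max_density R H) <= b%:R ->
         WC_value H n b = 0%N)].
Proof.
exists 1, 1; split=> // -[//|n] _; split=> b _.
  rewrite mul1r natr1.
  apply: le_trans (game_value_le _ _ _ (@card_copy H (complete_graph n.+1))) _.
  by rewrite ler_pM2r ?invr_gt0 ?exprn_gt0 ?ltr0n // -natrX ler_nat card_copies_le.
have [W [D [WD W_gt0 D_gt0 ->]]] := max_densityP R hH.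
rewrite mul1r div1r invf_div => nb.
(* Client plays against the copies of the densest subgraph [(W, D)]; it suffices that this value is
   below 1. *)
pose y0 : vertex (complete_graph n.+1) := ord0.
apply: (position_value_eq0 (F' := partial_copies y0 W D)) => [C|].
  exact: partial_copies_score_eq0.
apply/eqP; rewrite -leqn0 -ltnS -(ltr_nat R).
(* Maps that merge edges were filtered out, so all winning sets have the same size. *)
have cardD A : A \in partial_copies y0 W D -> #|A| = #|D|.
  by rewrite inE => /andP[_ /eqP].
apply: le_lt_trans (game_value_le _ _ _ cardD) _.
rewrite ltr_pdivrMr ?exprn_gt0 ?ltr0n // mul1r.
apply: (@le_lt_trans _ _ (n.+1%:R ^+ #|W|)).
  by rewrite -natrX ler_nat (leq_trans (card_partial_copies _ _ _)) // card_ord.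
(* With equal exponents only the bases are compared, and [b < b.+1] makes the inequality strict even
   for the constant 1. *)
have -> : n.+1%:R ^+ #|W| = (n.+1%:R `^ (#|W|%:R / #|D|%:R)) ^+ #|D| :> R.
  rewrite -[RHS]powR_mulrn ?powR_ge0 // -powRrM divfK ?powR_mulrn //.
  by rewrite pnatr_eq0 -lt0n.
rewrite ltr_pXn2r ?nnegrE ?powR_ge0 //.
by rewrite (le_lt_trans nb) // ltr_nat.
Qed.
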